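(* For every integer $n\ge 0$, $$T_{n+2}=\sum_{k=0}^{n+1}F_kT_{n-k},$$ where $F_k$ are the Fibonacci numbers and $T_j$ the tribonacci numbers extended to $j=-1$ by $T_{-1}=1$.
   Context: Fibonacci numbers: $F_0=0$, $F_1=1$, $F_k=F_{k-1}+F_{k-2}$. Tribonacci numbers: $T_0=T_1=0$, $T_2=1$, $T_n=T_{n-1}+T_{n-2}+T_{n-3}$ for $n\ge3$; the value $T_{-1}=1$ is obtained by extending the recurrence backwards via $T_{n-3}=T_n-T_{n-1}-T_{n-2}$. *)

(* Defs.v *)
From mathcomp Require Import all_boot all_order all_algebra.
From mathcomp Require Import zify.
Set Implicit Arguments.
Unset Strict Implicit.
Unset Printing Implicit Defensive.
Import GRing.Theory.
Local Open Scope ring_scope.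

Fixpoint fib (k : nat) : nat :=
  match k with
  | 0 => 0
  | k1.+1 => match k1 with
             | 0 => 1
             | k2.+1 => (fib k1 + fib k2)%N
             end
  end.

Fixpoint trib_up (n : nat) : int :=
  match n with
  | 0 => 0
  | n1.+1 => match n1 with
             | 0 => 0
             | n2.+1 => match n2 with
                        | 0 => 1
                        | n3.+1 => trib_up n1 + trib_up n2 + trib_up n3
                        end
             end
  end.

(* trib_down m is T_(2 - m), computed by running the recurrence backwards
   from T_2, T_1, T_0, i.e. T_(n - 3) = T_n - T_(n - 1) - T_(n - 2). *)
Fixpoint trib_down (m : nat) : int :=
  match m with
  | 0 => 1
  | m1.+1 => match m1 with
             | 0 => 0
             | m2.+1 => match m2 with
                        | 0 => 0
                        | m3.+1 => trib_down m3 - trib_down m2 - trib_down m1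
                        end
             end
  end.

(* Negz m is -(m + 1) = 2 - (m + 3). *)
Definition trib (j : int) : int :=
  match j with
  | Posz n => trib_up n
  | Negz m => trib_down m.+3
  end.

Lemma trib_N1 : trib (-1) = 1.
Proof. by []. Qed.

Lemma trib_rec (j : int) : trib j = trib (j - 1) + trib (j - 2) + trib (j - 3).
Proof.
case: j => [[|[|[|n]]]|m] //.
- have -> : n.+3%:Z - 1 = n.+2%:Z by lia.
  have -> : n.+3%:Z - 2 = n.+1%:Z by lia.
  by have -> : n.+3%:Z - 3 = n%:Z by lia.
have -> : Negz m - 1 = Negz m.+1 by lia.
have -> : Negz m - 2 = Negz m.+2 by lia.
have -> : Negz m - 3 = Negz m.+3 by lia.
rewrite /trib.
have -> : trib_down m.+3.+3
  = trib_down m.+3 - trib_down m.+3.+1 - trib_down m.+3.+2 by [].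
move: (trib_down m.+3) (trib_down m.+3.+1) (trib_down m.+3.+2) => a b c.
by lia.
Qed.

(* Main.v *)
Require Import Defs.
From mathcomp Require Import all_boot all_order all_algebra.
From mathcomp Require Import zify ring.
Import GRing.Theory.
Local Open Scope ring_scope.

(** Applying the tribonacci recurrence repeatedly to the leading term of [T_(j+2)]
    produces Fibonacci coefficients: after [m] steps the terms
    [F_k T_(j-k)], [k < m], are split off and the remainder is
    [F_(m+1) T_(j+2-m) + F_m (T_(j+1-m) + T_(j-m))]. For [j = n] and [m = n+2]
    the remainder is [F_(n+3) T_0 + F_(n+2) (T_(-1) + T_(-2)) = 0]. *)

Lemma trib_fib_partial_sum (j : int) (m : nat) :
  trib (j + 2) = \sum_(0 <= k < m) (fib k)%:Z * trib (j - k%:Z)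
    + (fib m.+1)%:Z * trib (j + 2 - m%:Z)
    + (fib m)%:Z * (trib (j + 1 - m%:Z) + trib (j - m%:Z)).
Proof.
elim: m => [|m ->].
  by rewrite big_geq // subr0 mul1r mul0r add0r addr0.
(* Expanding only the leading term gives T_(j+1-m) the coefficient F_(m+1) + F_m = F_(m+2). Of the
   F_(m+1) + F_m copies of T_(j-m), F_m form the new summand; the other F_(m+1) join those of
   T_(j-m-1) in the new remainder. *)
rewrite big_nat_recr //= (trib_rec (j + 2 - m%:Z)).
have -> : j + 2 - m%:Z - 1 = j + 1 - m%:Z by lia.
have -> : j + 2 - m%:Z - 2 = j - m%:Z by lia.
have -> : j + 2 - m%:Z - 3 = j - m.+1%:Z by lia.
have -> : j + 2 - m.+1%:Z = j + 1 - m%:Z by lia.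
have -> : j + 1 - m.+1%:Z = j - m%:Z by lia.
rewrite -/(fib m.+1) !PoszD.
ring.
Qed.

Theorem theorem15 (n : nat) :
  trib (n%:Z + 2) = \sum_(0 <= k < n.+2) (fib k)%:Z * trib (n%:Z - k%:Z).
Proof.
rewrite (trib_fib_partial_sum n%:Z n.+2).
have -> : n%:Z + 2 - n.+2%:Z = 0 by lia.
have -> : n%:Z + 1 - n.+2%:Z = -1 by lia.
have -> : n%:Z - n.+2%:Z = -2 by lia.
(* T_(-1) = 1 and T_(-2) = -1 cancel, as T_1 = T_0 + T_(-1) + T_(-2) with T_1 = T_0 = 0 forces. *)
have -> : trib (-1) + trib (-2) = 0 by [].
by rewrite !mulr0 !addr0.
Qed.
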